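(* Let $\mathcal{B}$ be a local behaviour. Then the following statements hold: (i) If $\mathcal{B}$ is controllable, then it satisfies the continuation property. (ii) If $\mathcal{B}$ satisfies the continuation property, then $\mathcal{B}$ is controllable if and only if it is controllable to $0$. (iii) $\mathcal{B}$ is controllable if and only if it is controllable to $0$ and satisfies the continuation property.
   Context: Intervals and (pre)sheaves. $\mathbf{Int}$ is the poset (under inclusion) of compact real intervals $[a,b]$, $a\le b$; $\mathbf{pInt}$ is the subposet of those with $a<b$. A presheaf of vector spaces $\mathcal{F}$ on $\mathbf{Int}$ (resp. $\mathbf{pInt}$) assigns to each interval a real vector space $\mathcal{F}[a,b]$ and to each inclusion of intervals in the category a linear restriction map, functorially. It is a sheaf if for all $a\le b\le c\le d$ (for $\mathbf{Int}$), resp. $a\le b<c\le d$ (for $\mathbf{pInt}$), and all $f\in\mathcal{F}[a,c]$, $g\in\mathcal{F}[b,d]$ with $f|_{[b,c]}=g|_{[b,c]}$ there is a unique $h\in\mathcal{F}[a,d]$ with $h|_{[a,c]}=f$, $h|_{[b,d]}=g$. A subsheaf of a sheaf $\mathcal{G}$ is a sheaf $\mathcal{F}$ with $\mathcal{F}[a,b]\subseteq\mathcal{G}[a,b]$ for all $[a,b]$, with inherited restriction maps. Function spaces. For $a<b$, $\mathcal{C}^{-1}[a,b]$ is the vector space of functions $f:[a,b]\setminus E\to\mathbb{R}$ with $E$ finite, modulo equality outside a finite set. For $L\in\mathbb{N}_0\cup\{\infty\}$, $\mathcal{C}^L[a,b]$ is the space of $L$ times continuously differentiable functions on $[a,b]$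 (one-sided derivatives at the endpoints). $\mathcal{C}^L_{\mathbf{pInt}}$ is the $\mathbf{pInt}$-sheaf $[a,b]\mapsto\mathcal{C}^L[a,b]$ with the usual restrictions; $(\cdot)^n$ denotes the $n$-fold product. Extension and local behaviours. Let $L\in\{-1,0,1,\dots,\infty\}$ and let $\mathcal{A}$ be a subsheaf of $(\mathcal{C}^L_{\mathbf{pInt}})^n$. The extension $\operatorname{ext}_L(\mathcal{A})$ to $\mathbf{Int}$ is defined by $\operatorname{ext}_L(\mathcal{A})[a,b]=\mathcal{A}[a,b]$ for $a<b$ and $\operatorname{ext}_L(\mathcal{A})[b,b]=\{b\}\times(\mathbb{R}^n)^{L+1}$ (meaning $\{b\}\times(\mathbb{R}^n)^{\mathbb{N}_0}$ if $L=\infty$, and the one-point space $\{b\}\times(\mathbb{R}^n)^0$ if $L=-1$), with restriction maps of $\mathcal{A}$ between nondegenerate intervals, and $f|_{[b,b]}=(b,f(b),\dot f(b),\dots,f^{(L)}(b))$ for $f\in\mathcal{A}[a,c]$, $a<c$, $b\in[a,c]$. The subsheaf $\mathcal{A}$ is called $L$-regular if $\operatorname{ext}_L(\mathcal{A})$ is a sheaf of vector spaces on $\mathbf{Int}$. A local behaviour is an $\mathbf{Int}$-sheaf of vector spaces of the form $\operatorname{ext}_L(\mathcal{A})$ with $\mathcal{A}$ an $L$-regular subsheaf of $(\mathcal{C}^L_{\mathbf{pInt}})^n$, for some $L\in\{-1,0,1,\dots,\infty\}$ and some $n$. Properties of an $\mathbf{Int}$-presheaf of vector spaces $\mathcal{S}$.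 Sections on consecutive intervals are called compatible if they have equal restrictions to each common endpoint: $f\in\mathcal{S}[a,b]$, $g\in\mathcal{S}[b,c]$, $h\in\mathcal{S}[c,d]$ are compatible iff $f|_{[b,b]}=g|_{[b,b]}$ and $g|_{[c,c]}=h|_{[c,c]}$. - Continuation property: for all $a<b$ and all $g\in\mathcal{S}[a,b]$ there exist $\varepsilon>0$, $f\in\mathcal{S}[a-\varepsilon,a]$ and $h\in\mathcal{S}[b,b+\varepsilon]$ such that $f,g,h$ are compatible. - $f\in\mathcal{S}[a,b]$ is controllable to $h\in\mathcal{S}[c,d]$ ($a<b<c<d$) if there is $g\in\mathcal{S}[b,c]$ such that $f,g,h$ are compatible. - $\mathcal{S}$ is controllable if for all $a<b<c<d$, every $f\in\mathcal{S}[a,b]$ is controllable to every $h\in\mathcal{S}[c,d]$. - $\mathcal{S}$ is controllable to $0$ if for all $a<b<c<d$, every $f\in\mathcal{S}[a,b]$ is controllable to $0\in\mathcal{S}[c,d]$. *)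

(* Defs.v *)
From HB Require Import structures.
From mathcomp Require Import all_boot all_order all_algebra.
From mathcomp Require Import all_classical all_reals all_analysis.

Set Implicit Arguments.
Unset Strict Implicit.
Unset Printing Implicit Defensive.

Import Order.TTheory GRing.Theory Num.Theory.
Import numFieldNormedType.Exports.
Local Open Scope classical_set_scope.
Local Open Scope ring_scope.

Section Submodule.
Variables (K : pzRingType) (V : lmodType K) (P : submodClosed V).

Definition submod := {x : V | x \in P}.
HB.instance Definition _ := SubChoice.on submod.
HB.instance Definition _ := [SubChoice_isSubLmodule of submod by <:].

End Submodule.

Section QuotientModule.
Variables (K : pzRingType) (V : lmodType K) (P : submodClosed V).

(* [submodClosed V] does not inherit [zmodClosed V], which the additive quotient
   requires. *)
Lemma quotmod_zmod_closed : zmod_closed P.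
Proof.
split=> [|x y xP yP]; first exact: rpred0.
by rewrite rpredD// -scaleN1r rpredZ.
Qed.
Definition quotmod_pred : {pred V} := P.
HB.instance Definition _ := GRing.isZmodClosed.Build V quotmod_pred
  quotmod_zmod_closed.

Definition quotmod := Quotient.quot quotmod_pred.
HB.instance Definition _ := GRing.Zmodule.on quotmod.
HB.instance Definition _ := EqQuotient.on quotmod.

Local Open Scope quotient_scope.
Definition quotmod_pi (x : V) : quotmod := \pi_quotmod x.

Lemma quotmod_piP x y : quotmod_pi x = quotmod_pi y <-> x - y \in P.
Proof.
rewrite -[_ \in P]/(x - y \in quotmod_pred) Quotient.idealrBE.
by split=> [h|/eqP//]; apply/eqP.
Qed.

Lemma quotmod_reprK (q : quotmod) : quotmod_pi (repr q) = q.
Proof. exact: reprK. Qed.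

Lemma quotmod_piD x y : quotmod_pi (x + y) = quotmod_pi x + quotmod_pi y.
Proof. by rewrite /quotmod_pi [LHS]raddfD. Qed.

Definition quotmod_scale (a : K) (q : quotmod) : quotmod :=
  quotmod_pi (a *: repr q).

Lemma quotmod_piZ a x : quotmod_pi (a *: x) = quotmod_scale a (quotmod_pi x).
Proof.
apply/quotmod_piP; rewrite -scalerBr rpredZ//; apply/quotmod_piP.
by rewrite quotmod_reprK.
Qed.

Lemma quotmod_scaleA a b q :
  quotmod_scale a (quotmod_scale b q) = quotmod_scale (a * b) q.
Proof. by rewrite -[q]quotmod_reprK -!quotmod_piZ scalerA. Qed.
Lemma quotmod_scale1 : left_id 1 quotmod_scale.
Proof. by move=> q; rewrite -[q]quotmod_reprK -!quotmod_piZ scale1r. Qed.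
Lemma quotmod_scaleDr : right_distributive quotmod_scale +%R.
Proof.
move=> a p q; rewrite -[p]quotmod_reprK -[q]quotmod_reprK.
by rewrite -quotmod_piD -!quotmod_piZ -quotmod_piD scalerDr.
Qed.
Lemma quotmod_scaleDl q : {morph quotmod_scale^~ q : a b / a + b}.
Proof.
move=> a b /=; rewrite -[q]quotmod_reprK.
by rewrite -!quotmod_piZ -quotmod_piD scalerDl.
Qed.
HB.instance Definition _ := GRing.Zmodule_isLmodule.Build K quotmod
  quotmod_scaleA quotmod_scale1 quotmod_scaleDr quotmod_scaleDl.

Lemma quotmod_pi_linear : linear quotmod_pi.
Proof. by move=> a x y; rewrite quotmod_piD quotmod_piZ. Qed.

End QuotientModule.

Section Intervals.
Variable R : realType.

Record itvposet := ItvPoset {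
  itv_sort :> Type;
  lo : itv_sort -> R;
  hi : itv_sort -> R }.

Definition itv_incl (C : itvposet) (J I : C) : bool :=
  (lo I <= lo J) && (hi J <= hi I).

Record seg := Seg { seg_lo : R; seg_hi : R; seg_lt : seg_lo < seg_hi }.

Definition pInt := @ItvPoset seg seg_lo seg_hi.

(* A compact interval [a, b] with a <= b is either the point [a, a] or has
   a < b.  With one constructor for each case, [ext] can be defined by
   pattern matching. *)
Inductive cpt := Point of R | Segment of seg.

Definition cpt_lo (I : cpt) : R :=
  match I with Point b => b | Segment s => seg_lo s end.
Definition cpt_hi (I : cpt) : R :=
  match I with Point b => b | Segment s => seg_hi s end.

Definition Int := @ItvPoset cpt cpt_lo cpt_hi.

Lemma itv_incl_trans (C : itvposet) (I J K : C) :
  itv_incl J I -> itv_incl K J -> itv_incl K I.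
Proof.
move=> /andP[h1 h2] /andP[h3 h4]; apply/andP; split.
  exact: le_trans h1 h3.
exact: le_trans h4 h2.
Qed.

Record presheaf (C : itvposet) := Presheaf {
  sec :> C -> lmodType R;
  res : forall I J : C, itv_incl J I -> {linear sec I -> sec J};
  res_id : forall (I : C) (h : itv_incl I I) (f : sec I), res h f = f;
  res_comp : forall (I J K : C) (hJI : itv_incl J I) (hKJ : itv_incl K J)
      (hKI : itv_incl K I) (f : sec I),
    res hKJ (res hJI f) = res hKI f }.

(* The intervals are [a, d], [a, c], [b, d] and [b, c]; the inclusions say
   a <= b and c <= d, while b <= c for Int and b < c for pInt because
   [b, c] is an object of C. *)
Definition is_sheaf (C : itvposet) (F : presheaf C) : Prop :=
  forall (a b c d : R) (Iad Iac Ibd Ibc : C),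
    lo Iad = a -> hi Iad = d -> lo Iac = a -> hi Iac = c ->
    lo Ibd = b -> hi Ibd = d -> lo Ibc = b -> hi Ibc = c ->
  forall (h1 : itv_incl Iac Iad) (h2 : itv_incl Ibd Iad)
    (h3 : itv_incl Ibc Iac) (h4 : itv_incl Ibc Ibd) (f : F Iac) (g : F Ibd),
    res F h3 f = res F h4 g ->
  exists! h : F Iad, res F h1 h = f /\ res F h2 h = g.

Section Power.
Variables (C : itvposet) (F : presheaf C) (n : nat).

Definition pow_sec (I : C) : lmodType R := ('I_n -> F I : lmodType R).

Section res.
Variables (I J : C) (h : itv_incl J I).
Definition pow_res_fun (f : pow_sec I) : pow_sec J := fun i => res F h (f i).
Lemma pow_res_linear : linear pow_res_fun.
Proof. by move=> a f g; apply/funext => i; rewrite /pow_res_fun linearP. Qed.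
HB.instance Definition _ :=
  GRing.isLinear.Build R (pow_sec I) (pow_sec J) _ pow_res_fun pow_res_linear.
Definition pow_res : {linear pow_sec I -> pow_sec J} := pow_res_fun.
End res.

Lemma pow_res_id I (h : itv_incl I I) (f : pow_sec I) : pow_res h f = f.
Proof. by apply/funext => i; exact: res_id. Qed.
Lemma pow_res_comp I J K (hJI : itv_incl J I) (hKJ : itv_incl K J)
  (hKI : itv_incl K I) (f : pow_sec I) :
  pow_res hKJ (pow_res hJI f) = pow_res hKI f.
Proof. by apply/funext => i; exact: res_comp. Qed.

Definition powpresheaf : presheaf C := Presheaf pow_res_id pow_res_comp.
End Power.

Record subpresheaf (C : itvposet) (G : presheaf C) := SubPresheaf {
  subsec :> forall I : C, submodClosed (G I);
  subsec_res : forall (I J : C) (h : itv_incl J I) (f : G I),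
    f \in subsec I -> res G h f \in subsec J }.

Section SubPresheafIsPresheaf.
Variables (C : itvposet) (G : presheaf C) (A : subpresheaf G).

Definition sub_sec (I : C) : lmodType R := (submod (A I) : lmodType R).

Section res.
Variables (I J : C) (h : itv_incl J I).
Definition sub_res_fun (f : sub_sec I) : sub_sec J :=
  exist (fun x => x \in A J) (res G h (val f)) (subsec_res h (valP f)).
Lemma sub_res_linear : linear sub_res_fun.
Proof. by move=> a f g; apply/val_inj; rewrite /= linearP. Qed.
HB.instance Definition _ :=
  GRing.isLinear.Build R (sub_sec I) (sub_sec J) _ sub_res_fun sub_res_linear.
Definition sub_res : {linear sub_sec I -> sub_sec J} := sub_res_fun.
End res.

Lemma sub_res_id I (h : itv_incl I I) (f : sub_sec I) : sub_res h f = f.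
Proof. by apply/val_inj; exact: res_id. Qed.
Lemma sub_res_comp I J K (hJI : itv_incl J I) (hKJ : itv_incl K J)
  (hKI : itv_incl K I) (f : sub_sec I) :
  sub_res hKJ (sub_res hJI f) = sub_res hKI f.
Proof. by apply/val_inj; exact: res_comp. Qed.

Definition presheaf_of_sub : presheaf C := Presheaf sub_res_id sub_res_comp.
End SubPresheafIsPresheaf.

Record subsheaf (C : itvposet) (G : presheaf C) := SubSheaf {
  subsheaf_sub :> subpresheaf G;
  subsheafP : is_sheaf (presheaf_of_sub subsheaf_sub) }.

Inductive smoothness := MinusOne | Fin of nat | Infty.

Definition smooth_ge (L : smoothness) (k : nat) : bool :=
  match L with MinusOne => false | Fin l => (k <= l)%N | Infty => true end.
Definition smooth_gt (L : smoothness) (k : nat) : bool :=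
  match L with MinusOne => false | Fin l => (k < l)%N | Infty => true end.

Definition dom (I : pInt) : topologicalType :=
  set_type ([set` `[lo I, hi I]] : set R).

Lemma mkdom_subproof (I : pInt) (x : R) :
  lo I <= x -> x <= hi I -> x \in ([set` `[lo I, hi I]] : set R).
Proof. by move=> h1 h2; rewrite inE /= in_itv /= h1 h2. Qed.

Definition mkdom (I : pInt) (x : R) (h1 : lo I <= x) (h2 : x <= hi I) :
  dom I := exist _ x (mkdom_subproof h1 h2).

Lemma dom_lo (I : pInt) (x : dom I) : lo I <= set_val x.
Proof. by have := set_valP x; rewrite /= in_itv => /andP[]. Qed.
Lemma dom_hi (I : pInt) (x : dom I) : set_val x <= hi I.
Proof. by have := set_valP x; rewrite /= in_itv => /andP[]. Qed.

Lemma itv_incl_lo (C : itvposet) (I J : C) : itv_incl J I -> lo I <= lo J.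
Proof. by case/andP. Qed.
Lemma itv_incl_hi (C : itvposet) (I J : C) : itv_incl J I -> hi J <= hi I.
Proof. by case/andP. Qed.

Definition dom_incl (I J : pInt) (h : itv_incl J I) (x : dom J) : dom I :=
  mkdom (le_trans (itv_incl_lo h) (dom_lo x))
        (le_trans (dom_hi x) (itv_incl_hi h)).

Lemma set_val_incl I J (h : itv_incl J I) x :
  set_val (@dom_incl I J h x) = set_val x.
Proof. by []. Qed.

Lemma dom_inj (I : pInt) (x y : dom I) : set_val x = set_val y -> x = y.
Proof. by move=> h; exact: val_inj. Qed.

(* y ranges over [a, b] only, so the derivative is one-sided at a and b. *)
Definition diffquot (I : pInt) (f : dom I -> R) (x y : dom I) : R :=
  (f y - f x) / (set_val y - set_val x).

Definition derivable_on (I : pInt) (f : dom I -> R) : Prop :=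
  forall x : dom I, cvg (diffquot f x @ x^').

Definition der (I : pInt) (f : dom I -> R) (x : dom I) : R :=
  lim (diffquot f x @ x^').

Definition is_CL (L : smoothness) (I : pInt) (f : dom I -> R) : Prop :=
  (forall k, smooth_gt L k -> derivable_on (iter k (@der I) f)) /\
  (forall k, smooth_ge L k -> continuous (iter k (@der I) f)).

Lemma set_val_continuous (I : pInt) : continuous (set_val : dom I -> R).
Proof. exact: initial_continuous. Qed.

Lemma dnbhs_dom_proper (I : pInt) (x : dom I) : ProperFilter x^'.
Proof.
apply: Build_ProperFilter_ex => P.
rewrite /dnbhs /within /= => -[U [[W oW WU] Ux] UP].
have {oW} : nbhs (set_val x) W.
  by apply: open_nbhs_nbhs; split=> //; move: Ux; rewrite -WU.
case/nbhs_ballP => e /= e0 xW.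
have hlt : lo I < hi I := seg_lt I.
have [y yx xye] : exists2 y : dom I, y != x & `|set_val x - set_val y| < e.
  have [xb|xb] := ltP (set_val x) (hi I).
  - pose t := Num.min (set_val x + e / 2) (hi I).
    have xt : set_val x < t by rewrite lt_min xb ltrDl divr_gt0.
    have tb : t <= hi I by rewrite ge_min lexx orbT.
    exists (mkdom (le_trans (dom_lo x) (ltW xt)) tb).
      by apply/eqP => /(congr1 set_val) /= h; move: (xt);
        rewrite lt_neqAle eq_sym [t == _](introT eqP h).
    rewrite /= distrC gtr0_norm ?subr_gt0// ltrBlDl.
    apply: (@le_lt_trans _ _ (set_val x + e / 2)).
      by rewrite ge_min lexx.
    by rewrite ltrD2l ltr_pdivrMr// ltr_pMr// ltr1n.
  - pose t := Num.max (set_val x - e / 2) (lo I).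
    have xt : t < set_val x.
      by rewrite gt_max (lt_le_trans hlt xb) ltrBlDr ltrDl divr_gt0.
    have tb : lo I <= t by rewrite le_max lexx orbT.
    exists (mkdom tb (le_trans (ltW xt) (dom_hi x))).
      by apply/eqP => /(congr1 set_val) /= h; move: (xt);
        rewrite lt_neqAle [t == _](introT eqP h).
    rewrite /= gtr0_norm ?subr_gt0// ltrBlDl -ltrBlDr.
    apply: (@lt_le_trans _ _ (set_val x - e / 2)); last by rewrite le_max lexx.
    by rewrite ltrD2l ltrN2 ltr_pdivrMr// ltr_pMr// ltr1n.
by exists y; apply: UP => //; rewrite -WU; apply: xW.
Qed.
#[local] Hint Extern 0 (ProperFilter (dnbhs _)) =>
  solve [apply: dnbhs_dom_proper] : typeclass_instances.

Section Restriction.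
Variables (I J : pInt) (h : itv_incl J I).

Lemma dom_incl_continuous : continuous (dom_incl h).
Proof.
move=> x U [V [[W oW <-] Wx] VU].
exists (set_val @^-1` W); split=> //; first by exists W.
by move=> y Wy; apply: (VU (dom_incl h y)).
Qed.

Lemma dom_incl_dnbhs (x : dom J) :
  dom_incl h y @[y --> x^'] --> (dom_incl h x)^'.
Proof.
move=> U; rewrite /dnbhs /within /= => /dom_incl_continuous.
move=> nU; apply: (@filterS _ (nbhs x) _ _ _ _ nU) => y /= Uy /= yx.
apply: Uy; apply: contra_neq yx.
by move=> xy; apply: dom_inj; rewrite -(set_val_incl h y) xy.
Qed.

Lemma diffquot_incl (f : dom I -> R) (x : dom J) :
  diffquot (f \o dom_incl h) x = diffquot f (dom_incl h x) \o dom_incl h.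
Proof. by []. Qed.

Lemma cvg_diffquot_incl (f : dom I -> R) (x : dom J) (l : R) :
  diffquot f (dom_incl h x) @ (dom_incl h x)^' --> l ->
  diffquot (f \o dom_incl h) x @ x^' --> l.
Proof. by rewrite diffquot_incl; apply: cvg_comp; exact: dom_incl_dnbhs. Qed.

Lemma derivable_on_incl (f : dom I -> R) :
  derivable_on f -> derivable_on (f \o dom_incl h).
Proof.
move=> df x; apply/cvg_ex; exists (der f (dom_incl h x)).
by apply: cvg_diffquot_incl; exact: df.
Qed.

Lemma der_incl (f : dom I -> R) :
  derivable_on f -> der (f \o dom_incl h) = der f \o dom_incl h.
Proof.
move=> df; apply/funext => x; apply: cvg_lim => //.
by apply: cvg_diffquot_incl; exact: df.
Qed.

Lemma iter_der_incl (f : dom I -> R) k :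
  (forall j, (j < k)%N -> derivable_on (iter j (@der I) f)) ->
  iter k (@der J) (f \o dom_incl h) = iter k (@der I) f \o dom_incl h.
Proof.
elim: k => [//|k IH] df; rewrite !iterS IH ?der_incl//; first exact: df.
by move=> j jk; apply: df; rewrite ltnS ltnW.
Qed.

End Restriction.

Section Linearity.
Variable I : pInt.
Implicit Types f g : dom I -> R.

Lemma cvg_diffquotP a f g (x : dom I) (l m : R) :
  diffquot f x @ x^' --> l -> diffquot g x @ x^' --> m ->
  diffquot (a *: f + g) x @ x^' --> a * l + m.
Proof.
move=> fl gm.
have -> : diffquot (a *: f + g) x = (a *: diffquot f x) + diffquot g x.
  apply/funext => y; rewrite /diffquot !fctE /=.
  rewrite /GRing.scale /= mulrA -mulrDl; congr (_ / _).
  by rewrite mulrBr opprD addrACA.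
by apply: cvgD => //; apply: cvgZr.
Qed.

Lemma derivable_onP a f g :
  derivable_on f -> derivable_on g -> derivable_on (a *: f + g).
Proof.
move=> df dg x; apply/cvg_ex; exists (a * der f x + der g x).
by apply: cvg_diffquotP; [exact: df|exact: dg].
Qed.

Lemma derP a f g : derivable_on f -> derivable_on g ->
  der (a *: f + g) = a *: der f + der g.
Proof.
move=> df dg; apply/funext => x; apply: cvg_lim => //.
by apply: cvg_diffquotP; [exact: df|exact: dg].
Qed.

Lemma iter_derP a f g k :
  (forall j, (j < k)%N -> derivable_on (iter j (@der I) f)) ->
  (forall j, (j < k)%N -> derivable_on (iter j (@der I) g)) ->
  iter k (@der I) (a *: f + g) = a *: iter k (@der I) f + iter k (@der I) g.
Proof.
elim: k => [//|k IH] df dg; rewrite !iterS IH ?derP//.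
- exact: df.
- exact: dg.
- by move=> j jk; apply: df; rewrite ltnS ltnW.
- by move=> j jk; apply: dg; rewrite ltnS ltnW.
Qed.

Lemma derivable_on0 : derivable_on (0 : dom I -> R).
Proof.
move=> x; apply/cvg_ex; exists 0.
rewrite (_ : diffquot _ _ = cst 0); first exact: cvg_cst.
by apply/funext => y; rewrite /diffquot !fctE subrr mul0r.
Qed.

Lemma der0 : der (0 : dom I -> R) = 0.
Proof.
apply/funext => x; apply: cvg_lim => //.
rewrite (_ : diffquot _ _ = cst 0); first exact: cvg_cst.
by apply/funext => y; rewrite /diffquot !fctE subrr mul0r.
Qed.

Lemma iter_der0 k : iter k (@der I) 0 = 0.
Proof. by elim: k => // k /= ->; exact: der0. Qed.

End Linearity.

Lemma smooth_ge_gt j k L : (j < k)%N -> smooth_ge L k -> smooth_gt L j.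
Proof. by case: L => //= l; exact: leq_trans. Qed.
Lemma smooth_gtW k L : smooth_gt L k -> smooth_ge L k.
Proof. by case: L => //= l; exact: ltnW. Qed.

Section CL.
Variables (L : smoothness) (I : pInt).

Lemma is_CL_iter (f : dom I -> R) k : is_CL L f -> smooth_ge L k ->
  forall j, (j < k)%N -> derivable_on (iter j (@der I) f).
Proof. by move=> [df _] kL j jk; apply: df; exact: smooth_ge_gt kL. Qed.

Definition CL_pred : {pred (dom I -> R)} := fun f => `[< is_CL L f >].

Lemma CL_predP (f : dom I -> R) : reflect (is_CL L f) (f \in CL_pred).
Proof. exact: asboolP. Qed.

Lemma CL_submod_closed : submod_closed CL_pred.
Proof.
split=> [|a f g /CL_predP cf /CL_predP cg]; apply/CL_predP.
  split=> k _; rewrite iter_der0; first exact: derivable_on0.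
  exact: cst_continuous.
split=> k kL.
  rewrite iter_derP; [|exact: is_CL_iter cf (smooth_gtW kL)|
                       exact: is_CL_iter cg (smooth_gtW kL)].
  by apply: derivable_onP; [exact: cf.1|exact: cg.1].
rewrite iter_derP; [|exact: is_CL_iter cf kL|exact: is_CL_iter cg kL].
by move=> x; exact: (cvgD (cvgZr (k := a) (cf.2 k kL x)) (cg.2 k kL x)).
Qed.
HB.instance Definition _ := GRing.isSubmodClosed.Build R (dom I -> R) CL_pred
  CL_submod_closed.

Definition CL_sub : lmodType R := (submod CL_pred : lmodType R).

Definition fin_supp : {pred (dom I -> R)} :=
  fun f => `[< finite_set [set x | f x <> 0] >].

Lemma fin_suppP (f : dom I -> R) :
  reflect (finite_set [set x | f x <> 0]) (f \in fin_supp).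
Proof. exact: asboolP. Qed.

Lemma fin_supp_submod_closed : submod_closed fin_supp.
Proof.
split=> [|a f g /fin_suppP ff /fin_suppP fg]; apply/fin_suppP.
  by rewrite (_ : [set _ | _] = set0)//; apply/seteqP; split.
apply: (@sub_finite_set _ _ ([set x | f x <> 0] `|` [set x | g x <> 0])).
  move=> x /=; rewrite !fctE => h.
  have [fx|/eqP fx] := eqVneq (f x) 0; last by left.
  by right=> gx; apply: h; rewrite fx gx scaler0 addr0.
by rewrite finite_setU.
Qed.
HB.instance Definition _ := GRing.isSubmodClosed.Build R (dom I -> R) fin_supp
  fin_supp_submod_closed.

(* A function defined on [a, b] minus a finite set is represented by any of
   its extensions to [a, b]; these differ only on a finite set, so the choice
   does not matter in the quotient. *)
Definition CMinusOne : lmodType R := (quotmod fin_supp : lmodType R).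

End CL.

Section CLRestriction.
Variables (L : smoothness) (I J : pInt) (h : itv_incl J I).

Lemma is_CL_incl (f : dom I -> R) : is_CL L f -> is_CL L (f \o dom_incl h).
Proof.
move=> cf; split=> k kL; rewrite iter_der_incl.
- by apply: derivable_on_incl; exact: cf.1.
- exact: is_CL_iter cf (smooth_gtW kL).
- move=> x; apply: continuous_comp; first exact: dom_incl_continuous.
  exact: cf.2.
- exact: is_CL_iter cf kL.
Qed.

Definition CL_sub_res_fun (f : CL_sub L I) : CL_sub L J :=
  exist (fun g : dom J -> R => g \in @CL_pred L J) (val f \o dom_incl h)
    (introT (CL_predP _ _) (is_CL_incl (elimT (CL_predP _ _) (valP f)))).
Lemma CL_sub_res_linear : linear CL_sub_res_fun.
Proof. by move=> a f g; apply/val_inj/funext. Qed.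
HB.instance Definition _ := GRing.isLinear.Build R (CL_sub L I) (CL_sub L J) _
  CL_sub_res_fun CL_sub_res_linear.

Lemma fin_supp_incl (f : dom I -> R) :
  f \in @fin_supp I -> f \o dom_incl h \in @fin_supp J.
Proof.
move=> /fin_suppP ff; apply/fin_suppP.
rewrite (_ : [set x | _] = dom_incl h @^-1` [set x | f x <> 0])//.
apply: finite_preimage => // x y _ _ xy.
by apply: dom_inj; rewrite -(set_val_incl h x) xy.
Qed.

Definition CMinusOne_res_fun (f : CMinusOne I) : CMinusOne J :=
  quotmod_pi (@fin_supp J) (repr (f : quotmod (@fin_supp I)) \o dom_incl h).

Lemma CMinusOne_resE (f : dom I -> R) :
  CMinusOne_res_fun (quotmod_pi (@fin_supp I) f) =
  quotmod_pi (@fin_supp J) (f \o dom_incl h).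
Proof.
apply/quotmod_piP; apply: (@fin_supp_incl (_ - _)).
by apply/quotmod_piP; exact: quotmod_reprK.
Qed.

Lemma CMinusOne_res_linear : linear CMinusOne_res_fun.
Proof.
move=> a f g.
rewrite -[f](@quotmod_reprK _ _ (@fin_supp I)).
rewrite -[g](@quotmod_reprK _ _ (@fin_supp I)).
by rewrite -quotmod_pi_linear !CMinusOne_resE -quotmod_pi_linear.
Qed.
HB.instance Definition _ :=
  GRing.isLinear.Build R (CMinusOne I) (CMinusOne J) _
    CMinusOne_res_fun CMinusOne_res_linear.

End CLRestriction.

Definition CL_sec (L : smoothness) (I : pInt) : lmodType R :=
  match L with MinusOne => CMinusOne I | _ => CL_sub L I end.

Definition CL_res (L : smoothness) (I J : pInt) (h : itv_incl J I) :
    {linear CL_sec L I -> CL_sec L J} :=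
  match L return {linear CL_sec L I -> CL_sec L J} with
  | MinusOne => CMinusOne_res_fun h
  | Fin l => @CL_sub_res_fun (Fin l) I J h
  | Infty => @CL_sub_res_fun Infty I J h
  end.

Lemma CL_res_id L (I : pInt) (h : itv_incl I I) (f : CL_sec L I) :
  CL_res L h f = f.
Proof.
have hE : dom_incl h = id by apply/funext => x; exact: dom_inj.
case: L f => [|l|] /= f; last 2 first.
- by apply/val_inj; rewrite /= hE.
- by apply/val_inj; rewrite /= hE.
by rewrite /CMinusOne_res_fun hE; exact: quotmod_reprK.
Qed.

Lemma CL_res_comp L (I J K : pInt) (hJI : itv_incl J I) (hKJ : itv_incl K J)
    (hKI : itv_incl K I) (f : CL_sec L I) :
  CL_res L hKJ (CL_res L hJI f) = CL_res L hKI f.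
Proof.
have hE : dom_incl hJI \o dom_incl hKJ = dom_incl hKI.
  by apply/funext => x; exact: dom_inj.
case: L f => [|l|] /= f; last 2 first.
- by apply/val_inj; rewrite /= -hE.
- by apply/val_inj; rewrite /= -hE.
rewrite -[f](@quotmod_reprK _ _ (@fin_supp I)) !CMinusOne_resE.
by rewrite -hE.
Qed.

Definition CL (L : smoothness) : presheaf pInt :=
  Presheaf (@CL_res_id L) (@CL_res_comp L).

(* Jets of order L, i.e. (R^n)^(L+1).  The factor {b} of {b} x (R^n)^(L+1) is
   left out: the fibre over the point [b, b] is indexed by b already. *)
Definition jet (L : smoothness) (n : nat) : lmodType R :=
  ({k : nat | smooth_ge L k} -> 'rV[R]_n : lmodType R).

(* The value for L = -1 is irrelevant: there are then no k with k <= L. *)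
Definition CL_der (L : smoothness) (I : pInt) (k : nat) :
    CL_sec L I -> dom I -> R :=
  match L return CL_sec L I -> dom I -> R with
  | MinusOne => fun _ _ => 0
  | Fin l => fun f => iter k (@der I) (val (f : submod (@CL_pred (Fin l) I)))
  | Infty => fun f => iter k (@der I) (val (f : submod (@CL_pred Infty I)))
  end.

Lemma CL_der_linear L (I : pInt) k (x : dom I) a (f g : CL_sec L I) :
  smooth_ge L k -> CL_der k (a *: f + g) x = a * CL_der k f x + CL_der k g x.
Proof.
case: L f g => [//|l|] /= f g kL; rewrite iter_derP//.
- by apply: (@is_CL_iter (Fin l) _ _ k) => //; exact/CL_predP/valP.
- by apply: (@is_CL_iter (Fin l) _ _ k) => //; exact/CL_predP/valP.
- by apply: (@is_CL_iter Infty _ _ k) => //; exact/CL_predP/valP.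
- by apply: (@is_CL_iter Infty _ _ k) => //; exact/CL_predP/valP.
Qed.

Lemma CL_der_res L (I J : pInt) (h : itv_incl J I) k (x : dom J)
    (f : CL_sec L I) :
  smooth_ge L k -> CL_der k (CL_res L h f) x = CL_der k f (dom_incl h x).
Proof.
case: L f => [//|l|] /= f kL; rewrite iter_der_incl//.
- by apply: (@is_CL_iter (Fin l) _ _ k) => //; exact/CL_predP/valP.
- by apply: (@is_CL_iter Infty _ _ k) => //; exact/CL_predP/valP.
Qed.

Section Extension.
Variables (L : smoothness) (n : nat) (A : subsheaf (powpresheaf (CL L) n)).
Local Notation PA := (presheaf_of_sub A).

Section Jet.
Variables (I : pInt) (b : dom I).
Definition jet_at_fun (f : PA I) : jet L n :=
  fun k => \row_i CL_der (val k) ((val f : 'I_n -> CL L I) i) b.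
Lemma jet_at_linear : linear jet_at_fun.
Proof.
move=> a f g; apply/funext => k; apply/rowP => i.
by rewrite !mxE CL_der_linear ?(valP k)// !mxE.
Qed.
HB.instance Definition _ :=
  GRing.isLinear.Build R (PA I) (jet L n) _ jet_at_fun jet_at_linear.
Definition jet_at : {linear PA I -> jet L n} := jet_at_fun.
End Jet.

Definition ext_sec (I : Int) : lmodType R :=
  match I with Point _ => jet L n | Segment s => PA s end.

(* The third case does not occur: a point contains no nondegenerate
   interval. *)
Definition ext_res (I J : Int) :
    itv_incl J I -> {linear ext_sec I -> ext_sec J} :=
  match I, J return @itv_incl Int J I -> {linear ext_sec I -> ext_sec J} with
  | Segment s, Segment t => fun h => res PA (h : @itv_incl pInt t s)
  | Segment s, Point b => fun h =>
      jet_at (@mkdom s b (itv_incl_lo h) (itv_incl_hi h))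
  | Point b, Segment t => fun _ => (\0 : {linear jet L n -> PA t})
  | Point _, Point _ => fun _ => (idfun : {linear jet L n -> jet L n})
  end.

Lemma point_no_seg (b : R) (t : seg) :
  ~ @itv_incl Int (Segment t) (Point b).
Proof.
move=> /andP[/= h1 h2]; have := le_trans h2 h1.
by rewrite leNgt (seg_lt t).
Qed.

Lemma ext_res_id (I : Int) (h : itv_incl I I) (f : ext_sec I) : ext_res h f = f.
Proof. by case: I h f => [b|s] h f //=; exact: (res_id (p := PA)). Qed.

Lemma ext_res_comp (I J K : Int) (hJI : itv_incl J I) (hKJ : itv_incl K J)
    (hKI : itv_incl K I) (f : ext_sec I) :
  ext_res hKJ (ext_res hJI f) = ext_res hKI f.
Proof.
case: I J K hJI hKJ hKI f => [a|s] [b|t] [c|u] hJI hKJ hKI f //.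
- by case: (point_no_seg hJI).
- by case: (point_no_seg hJI).
- have bc : b = c.
    case/andP: hKJ => /= bc cb.
    by apply: le_anti; rewrite bc cb.
  by subst c; apply/funext => k; apply/rowP => i; rewrite !mxE; congr CL_der;
    exact: dom_inj.
- by case: (point_no_seg hKJ).
- apply/funext => k; apply/rowP => i; rewrite !mxE.
  rewrite [LHS](CL_der_res _ _ _ (valP k)).
  by congr CL_der; exact: dom_inj.
- exact: (res_comp (p := PA)).
Qed.

Definition ext : presheaf Int := Presheaf ext_res_id ext_res_comp.

Definition regular : Prop := is_sheaf ext.

End Extension.

Definition local_behaviour (B : presheaf Int) : Prop :=
  exists (L : smoothness) (n : nat) (A : subsheaf (powpresheaf (CL L) n)),
    regular A /\ B = ext A.

Section Control.
Variable S : presheaf Int.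

Definition sections (a b : R) (ab : a < b) : lmodType R :=
  S (Segment (Seg ab)).

Lemma itv_incl_left (a b : R) (ab : a < b) :
  @itv_incl Int (Point a) (Segment (Seg ab)).
Proof. by rewrite /itv_incl /= lexx ltW. Qed.
Lemma itv_incl_right (a b : R) (ab : a < b) :
  @itv_incl Int (Point b) (Segment (Seg ab)).
Proof. by rewrite /itv_incl /= lexx ltW. Qed.

Definition compatible (a b c d : R) (ab : a < b) (bc : b < c) (cd : c < d)
    (f : sections ab) (g : sections bc) (h : sections cd) : Prop :=
  res S (itv_incl_right ab) f = res S (itv_incl_left bc) g /\
  res S (itv_incl_right bc) g = res S (itv_incl_left cd) h.

Definition continuation_property : Prop :=
  forall (a b : R) (ab : a < b) (g : sections ab),
  exists (e : R) (e0 : 0 < e) (ea : a - e < a) (be : b < b + e)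
         (f : sections ea) (h : sections be),
    compatible f g h.

Definition controllable_sections (a b c d : R)
    (ab : a < b) (bc : b < c) (cd : c < d)
    (f : sections ab) (h : sections cd) : Prop :=
  exists g : sections bc, compatible f g h.

Definition controllable : Prop :=
  forall (a b c d : R) (ab : a < b) (bc : b < c) (cd : c < d)
    (f : sections ab) (h : sections cd), controllable_sections bc f h.

Definition controllable_to_zero : Prop :=
  forall (a b c d : R) (ab : a < b) (bc : b < c) (cd : c < d)
    (f : sections ab), controllable_sections bc f (0 : sections cd).

End Control.

End Intervals.

(* Main.v *)
Require Import Defs.
From mathcomp Require Import all_boot all_order all_algebra.
From mathcomp Require Import all_classical all_reals all_analysis.
From mathcomp Require Import lra.

(** A local behaviour enters only as a sheaf of vector spaces on compact
    intervals: the argument uses gluing at a point and linearity.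

    A controllable behaviour continues every section to the left and to the
    right, since the section can be reached from 0 and steered to 0
    ([controllable_continuation]).

    Conversely, suppose that [f] on [[a, b]] is to be steered to [h] on
    [[c, d]].  Steering to 0 is a statement about the future of a section,
    whereas [h] has to be reached from 0, which concerns its past.  Continuation
    and linearity convert one into the other: continue [h] to the left by some
    section, steer that continuation to 0 at time [c], and subtract.  The
    difference starts at 0 at some time [q] in the interval from [b] to [c] and
    still arrives at [h], because what was subtracted vanishes at [c]
    ([reach_from_zero]).  It remains to steer [f] to 0 at time [q] and to glue
    the two sections there ([continuation_controllable]). *)

Set Implicit Arguments.
Unset Strict Implicit.
Unset Printing Implicit Defensive.

Import Order.TTheory GRing.Theory Num.Theory.
Local Open Scope ring_scope.

Section Controllability.
Variables (R : realType) (S : presheaf (Int R)).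

Lemma controllable_controllable_to_zero :
  controllable S -> controllable_to_zero S.
Proof. by move=> ctrl a b c d ab bc cd f; exact: ctrl. Qed.

Lemma controllable_continuation : controllable S -> continuation_property S.
Proof.
move=> ctrl a b ab g.
have a21 : a - 2 < a - 1 by lra.
have a10 : a - 1 < a by lra.
have b01 : b < b + 1 by lra.
have b12 : b + 1 < b + 2 by lra.
have [f [_ fg]] := ctrl _ _ _ _ a21 a10 ab 0 g.
have [h [gh _]] := ctrl _ _ _ _ ab b01 b12 g 0.
by exists 1, ltr01, a10, b01, f, h.
Qed.

(** Gluing two sections at a common endpoint is the sheaf condition whose
    overlap is a degenerate interval. *)
Lemma sheaf_glue_at_point (a b c : R) (ab : a < b) (bc : b < c) (ac : a < c)
    (f : sections S ab) (g : sections S bc) : is_sheaf S ->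
  res S (itv_incl_right ab) f = res S (itv_incl_left bc) g ->
  exists h : sections S ac,
    res S (itv_incl_left ac) h = res S (itv_incl_left ab) f /\
    res S (itv_incl_right ac) h = res S (itv_incl_right bc) g.
Proof.
move=> sheafS fg.
have iab : @itv_incl _ (Int R) (Segment (Seg ab)) (Segment (Seg ac)).
  by rewrite /itv_incl /= lexx ltW.
have ibc : @itv_incl _ (Int R) (Segment (Seg bc)) (Segment (Seg ac)).
  by rewrite /itv_incl /= lexx andbT ltW.
have [h [[hf hg] _]] := sheafS a b b c (Segment (Seg ac)) (Segment (Seg ab))
  (Segment (Seg bc)) (Point b) erefl erefl erefl erefl erefl erefl erefl erefl
  iab ibc (itv_incl_right ab) (itv_incl_left bc) f g fg.
by exists h; rewrite -hf -hg; split; apply/esym; exact: res_comp.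
Qed.

(** A left continuation [k] of [h] past some [q], minus a section steering [k]
    from its state at [q] to 0 at [c], joins 0 to [h]. *)
Lemma reach_from_zero (b c d : R) (bc : b < c) (cd : c < d)
    (h : sections S cd) :
  continuation_property S -> controllable_to_zero S ->
  exists (q : R) (_ : b < q) (qc : q < c) (v : sections S qc),
    res S (itv_incl_left qc) v = 0 /\
    res S (itv_incl_right qc) v = res S (itv_incl_left cd) h.
Proof.
move=> cont ctz.
have [e [e0 [ec [_ [k [_ [kh _]]]]]]] := cont _ _ cd h.
pose p := Num.max b (c - e).
have pc : p < c by rewrite gt_max bc.
have bp : b <= p by rewrite le_max lexx.
have ep : c - e <= p by rewrite le_max lexx orbT.
pose q := (p + c) / 2.
have pq : p < q by rewrite /q; lra.
have qc : q < c by rewrite /q; lra.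
have ipq : @itv_incl _ (Int R) (Segment (Seg pq)) (Segment (Seg ec)).
  by rewrite /itv_incl /= ep ltW.
have iqc : @itv_incl _ (Int R) (Segment (Seg qc)) (Segment (Seg ec)).
  by rewrite /itv_incl /= lexx andbT (le_trans ep (ltW pq)).
have iq : @itv_incl _ (Int R) (Point q) (Segment (Seg ec)).
  exact: itv_incl_trans iqc (itv_incl_left qc).
have [w [kw w0]] := ctz _ _ _ _ pq qc cd (res S ipq k).
exists q, (le_lt_trans bp pq), qc, (res S iqc k - w); split.
  rewrite raddfB /= -kw.
  by rewrite (res_comp iqc (itv_incl_left qc) iq)
             (res_comp ipq (itv_incl_right pq) iq) subrr.
rewrite raddfB /= w0 raddf0 subr0 -kh.
exact: res_comp.
Qed.

Lemma continuation_controllable : is_sheaf S ->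
  continuation_property S -> controllable_to_zero S -> controllable S.
Proof.
move=> sheafS cont ctz a b c d ab bc cd f h.
have [q [bq [qc [v [v0 vh]]]]] := reach_from_zero bc h cont ctz.
have [u [fu u0]] := ctz _ _ _ _ ab bq qc f.
have uv : res S (itv_incl_right bq) u = res S (itv_incl_left qc) v.
  by rewrite v0 u0 raddf0.
have [g [gu gv]] := sheaf_glue_at_point bc sheafS uv.
by exists g; split; rewrite ?gu ?gv.
Qed.

End Controllability.

Theorem theorem3p5 (R : realType) (B : presheaf (Int R))
    (hB : local_behaviour B) :
  (controllable B -> continuation_property B) /\
  (continuation_property B -> (controllable B <-> controllable_to_zero B)) /\
  (controllable B <-> controllable_to_zero B /\ continuation_property B).
Proof.
have sheafB : is_sheaf B by case: hB => L [n [A [regA ->]]].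
have ctrl_cont := @controllable_continuation R B.
have ctrl_zero := @controllable_controllable_to_zero R B.
have cont_ctrl := continuation_controllable sheafB.
by split=> //; split=> [cont|]; split; try case; auto.
Qed.
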